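(* For every $d\ge 2$, the truncated point scheme $V_d\subseteq(\mathbb{P}^2)^{\times d}$ of $S(1,1,1)$ is the union of the length $d$ paths of the quiver $Q$; that is, $$V_d=\bigcup_{v_1\to v_2\to\cdots\to v_d} v_1\times v_2\times\cdots\times v_d,$$ where the union is over all sequences $(v_1,\dots,v_d)$ of vertices of $Q$ such that there is an arrow $v_i\to v_{i+1}$ in $Q$ for each $1\le i\le d-1$, and each vertex $v_i$ is regarded as the corresponding closed subvariety (a line or a point) of $\mathbb{P}^2$. (For example, for $d=2$ the path $\mathbb{P}^1_A\to p_a$ corresponds to the component $\mathbb{P}^1_A\times p_a$ of $V_2$.)
   Context: Let $k$ be an algebraically closed field of characteristic $0$, and let $\mathbb{P}^2=\mathbb{P}^2_k$ with homogeneous coordinates $[x:y:z]$. The degenerate Sklyanin algebra $S=S(1,1,1)$ is the graded $k$-algebra generated by $x,y,z$ in degree 1 subject to the relations $yz+zy+x^2=0$, $zx+xz+y^2=0$, $xy+yx+z^2=0$. For $d\ge 1$, the truncated point scheme of length $d$ of $S$ is the closed subscheme $V_d\subseteq(\mathbb{P}^2)^{\times d}$ defined by the multilinearizations of the relations of $S$: writing a point of $(\mathbb{P}^2)^{\times d}$ as $(p_0,\dots,p_{d-1})$ with $p_i=[x_i:y_i:z_i]$, it is cut out by $f_i=g_i=h_i=0$ for $0\le i\le d-2$, where $f_i=y_iz_{i+1}+z_iy_{i+1}+x_ix_{i+1}$, $g_i=z_ix_{i+1}+x_iz_{i+1}+y_iy_{i+1}$, $h_i=x_iy_{i+1}+y_ix_{i+1}+z_iz_{i+1}$.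 Let $\zeta=e^{2\pi i/3}$ (a primitive cube root of unity in $k$). Set $p_a=[1:1:1]$, $p_b=[1:\zeta:\zeta^2]$, $p_c=[1:\zeta^2:\zeta]$ (each also denoting the corresponding one-point subvariety). Define the projective lines in $\mathbb{P}^2$ $\mathbb{P}^1_A: x+y+z=0$, $\mathbb{P}^1_B: x+\zeta^2y+\zeta z=0$, $\mathbb{P}^1_C: x+\zeta y+\zeta^2z=0$. The quiver $Q$ has six vertices $\mathbb{P}^1_A,\mathbb{P}^1_B,\mathbb{P}^1_C,p_a,p_b,p_c$ and exactly the following twelve arrows: $\mathbb{P}^1_A\to p_a$, $p_a\to\mathbb{P}^1_A$, $\mathbb{P}^1_B\to p_b$, $p_b\to\mathbb{P}^1_B$, $\mathbb{P}^1_C\to p_c$, $p_c\to\mathbb{P}^1_C$, $p_a\to p_b$, $p_b\to p_a$, $p_a\to p_c$, $p_c\to p_a$, $p_b\to p_c$, $p_c\to p_b$. A ''length $d$ path'' of $Q$ means a path passing through $d$ vertices (counted with repetition). *)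

(* Defs.v *)
From HB Require Import structures.
From mathcomp Require Import all_boot all_order all_algebra.
From mathcomp Require Import mpoly.

Set Implicit Arguments.
Unset Strict Implicit.
Unset Printing Implicit Defensive.

Import GRing.Theory.
Local Open Scope ring_scope.

(** A k-point (p_0, ..., p_{d-1}) of (P^2)^d is represented by a d x 3 matrix
    whose i-th row is a nonzero vector [x_i : y_i : z_i] of homogeneous
    coordinates of p_i; every condition imposed on such a matrix below is
    invariant under rescaling each row.  The multihomogeneous coordinate ring of
    (P^2)^d is the polynomial ring in the 3d variables x_i, y_i, z_i, numbered by
    mxvec_index so that evaluation at a matrix goes through mxvec.

    A multihomogeneous ideal I defines a closed subscheme of (P^2)^d.  For a
    choice c of one coordinate in each factor, let U_c be the affine chart on
    which the product m_c of the chosen coordinates is invertible; a form f lies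
    in the ideal of the subscheme on U_c iff m_c^N f is in I for some N.  Hence
    two ideals define the same closed subscheme iff they have the same
    saturation, the set of f that lie in the ideal on every chart U_c. *)

Section MultiProjective.
Variables (k : fieldType) (d : nat).

Definition coord_ring := {mpoly k[d * 3]}.

Definition coordinate (i : 'I_d) (j : 'I_3) : coord_ring :=
  'X_(mxvec_index i j).

Definition is_multipoint (p : 'M[k]_(d, 3)) : Prop :=
  forall i, row i p != 0.

Definition eval_at (p : 'M[k]_(d, 3)) (f : coord_ring) : k :=
  f.@[fun t => mxvec p 0 t].

Definition ideal_generated (G : coord_ring -> Prop) (f : coord_ring) : Prop :=
  exists s : seq (coord_ring * coord_ring),
    (forall u, u \in s -> G u.2) /\ f = \sum_(u <- s) u.1 * u.2.

Definition saturation (I : coord_ring -> Prop) (f : coord_ring) : Prop :=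
  forall c : 'I_d -> 'I_3,
    exists N : nat, I ((\prod_i coordinate i (c i)) ^+ N * f).

Definition same_closed_subscheme (I J : coord_ring -> Prop) : Prop :=
  forall f, saturation I f <-> saturation J f.

Definition zero_locus (I : coord_ring -> Prop) (p : 'M[k]_(d, 3)) : Prop :=
  forall f, I f -> eval_at p f = 0.

(** Ideal of a closed subvariety, i.e. of a closed set of points with its
    reduced structure. *)
Definition vanishing_ideal (X : 'M[k]_(d, 3) -> Prop) (f : coord_ring) : Prop :=
  forall p, is_multipoint p -> X p -> eval_at p f = 0.

Let x i := coordinate i 0.
Let y i := coordinate i 1.
Let z i := coordinate i 2.

(** Multilinearizations of yz + zy + x^2, zx + xz + y^2, xy + yx + z^2. *)
Definition rel_f (i j : 'I_d) : coord_ring := y i * z j + z i * y j + x i * x j.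
Definition rel_g (i j : 'I_d) : coord_ring := z i * x j + x i * z j + y i * y j.
Definition rel_h (i j : 'I_d) : coord_ring := x i * y j + y i * x j + z i * z j.

Definition truncated_relation (r : coord_ring) : Prop :=
  exists i j : 'I_d, j = i.+1 :> nat /\
    [\/ r = rel_f i j, r = rel_g i j | r = rel_h i j].

Definition truncated_point_ideal : coord_ring -> Prop :=
  ideal_generated truncated_relation.

End MultiProjective.

Inductive vertex := LineA | LineB | LineC | PtA | PtB | PtC.

Definition arrow : rel vertex := fun v w =>
  match v, w with
  | LineA, PtA | PtA, LineA
  | LineB, PtB | PtB, LineB
  | LineC, PtC | PtC, LineC
  | PtA, PtB | PtB, PtA
  | PtA, PtC | PtC, PtA
  | PtB, PtC | PtC, PtB => true
  | _, _ => false
  end.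

Definition is_path d (v : d.-tuple vertex) : bool := sorted arrow v.

Section Paths.
Variables (k : fieldType) (zeta : k).

Definition hcoords (a b c : k) : 'rV[k]_3 := \row_j [:: a; b; c]`_j.

Definition same_point (q q' : 'rV[k]_3) : Prop :=
  exists2 c : k, c != 0 & q = c *: q'.

(** The subvariety of P^2 attached to a vertex; q is nonzero in all uses. *)
Definition in_vertex (v : vertex) (q : 'rV[k]_3) : Prop :=
  let x := q 0 0 in let y := q 0 1 in let z := q 0 2 in
  match v with
  | LineA => x + y + z = 0
  | LineB => x + zeta ^+ 2 * y + zeta * z = 0
  | LineC => x + zeta * y + zeta ^+ 2 * z = 0
  | PtA => same_point q (hcoords 1 1 1)
  | PtB => same_point q (hcoords 1 zeta (zeta ^+ 2))
  | PtC => same_point q (hcoords 1 (zeta ^+ 2) zeta)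
  end.

Definition path_product d (v : d.-tuple vertex) (p : 'M[k]_(d, 3)) : Prop :=
  forall i : 'I_d, in_vertex (tnth v i) (row i p).

(** The union of finitely many closed subschemes is defined by the
    intersection of their ideals. *)
Definition path_union_ideal d (f : coord_ring k d) : Prop :=
  forall v : d.-tuple vertex, is_path v -> vanishing_ideal (path_product v) f.

End Paths.

(* Main.v *)
(** In the coordinates u = x + y + z, v = x + zeta^2 y + zeta z and
    w = x + zeta y + zeta^2 z (the columns of [fourier (zeta ^+ 2)]) the
    relations become u_i u_{i+1}, v_i v_{i+1}, w_i w_{i+1}, the lines become
    coordinate lines and p_a, p_b, p_c become coordinate points.  Hence the ideal
    is squarefree monomial, so reduced, and a point lies on V_d iff the sets of
    coordinates vanishing at consecutive p_i cover {u, v, w}; these sets being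
    proper and d >= 2, they are also nonempty, and covering is adjacency in Q.
    For the scheme structure, multiplication by one diagonal coordinate per
    factor sends a form vanishing on V_d into the ideal, and a product of
    original coordinates is a linear combination of such diagonal products. *)

Require Import Defs.
From HB Require Import structures.
From mathcomp Require Import all_boot all_order all_algebra.
From mathcomp Require Import mpoly.
From mathcomp Require Import ring.
Set Implicit Arguments.
Unset Strict Implicit.
Unset Printing Implicit Defensive.
Import GRing.Theory.
Local Open Scope ring_scope.

(** * Indices in ['I_3], and vanishing of polynomial coefficients *)

Lemma forall_ord3 (Q : 'I_3 -> Prop) : Q 0 -> Q 1 -> Q 2 -> forall j, Q j.
Proof.
move=> Q0 Q1 Q2; case=> [[|[|[|//]]] lt_j].
- by rewrite (_ : Ordinal lt_j = 0) //; apply: val_inj.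
- by rewrite (_ : Ordinal lt_j = 1) //; apply: val_inj.
- by rewrite (_ : Ordinal lt_j = 2) //; apply: val_inj.
Qed.

Lemma sum_ord3 (V : nmodType) (F : 'I_3 -> V) :
  \sum_j F j = F 0 + F 1 + F 2.
Proof.
rewrite !big_ord_recl big_ord0 addr0 addrA.
by congr (F _ + F _ + F _); apply: val_inj.
Qed.

(* Scaling one variable separates the monomials by their exponent in it. *)
Lemma mcoeff_eq0_scalable (k : closedFieldType) n (Om : ('I_n -> k) -> Prop)
    (g : {mpoly k[n]}) (m0 : 'X_{1..n}) :
  (forall v t a, a != 0 -> Om v ->
     Om (fun i => if i == t then a * v i else v i)) ->
  (forall v, Om v -> g.@[v] = 0) ->
  (exists2 v, Om v & 'X_[m0].@[v] != 0) -> g@_m0 = 0.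
Proof.
move=> scaleOm g0 [v0 Om_v0 v0_neq0].
(* Induction on [s]: the part of [g] whose exponents agree with those of [m0] on [s] still vanishes
   on [Om]. *)
have comp0 (s : seq 'I_n) v : Om v ->
    \sum_(m <- msupp g | all (fun t => m t == m0 t) s)
       g@_m * 'X_[m].@[v] = 0.
  elim: s v => [|t s IHs] v Om_v /=.
    rewrite -[RHS](g0 v Om_v) mevalE; apply: eq_bigr => m _.
    by rewrite mevalX.
  pose sc a := fun i => if i == t then a * v i else v i.
  have monom_sc a m : 'X_[m].@[sc a] = a ^+ m t * 'X_[m].@[v].
    rewrite !mevalX (bigD1 t) //= [in RHS](bigD1 t) //= /sc eqxx exprMn -mulrA.
    by congr (_ * (_ * _)); apply: eq_bigr => i /negPf ->.
  (* At a nonzero [a], [q] takes the value of the previous partial sum at the rescaled point, hence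
     vanishes; its coefficient of degree [m0 t] is the new partial sum. *)
  pose q : {poly k} := \sum_(m <- msupp g | all (fun t => m t == m0 t) s)
     (g@_m * 'X_[m].@[v]) *: 'X^(m t).
  suff q0 : q = 0.
    have /= := congr1 (fun r : {poly k} => r`_(m0 t)) q0.
    rewrite coef0 coef_sum => q_t; rewrite -[RHS]q_t big_mkcondl /=.
    apply: eq_bigr => m _; rewrite coefZ coefXn eq_sym.
    by case: eqP; rewrite ?mulr1 ?mulr0.
  apply/eqP/negPn/negP => q_neq0.
  (* The factor ['X] makes the nonroot [a] nonzero, hence an admissible scaling. *)
  have /closed_nonrootP[a] : q * 'X != 0 by rewrite mulf_neq0 ?polyX_eq0.
  rewrite rootE hornerMX mulf_eq0 negb_or => /andP[/negP qa a_neq0]; apply: qa.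
  rewrite -(IHs (sc a)); last exact: scaleOm.
  rewrite horner_sum; apply/eqP/eq_bigr => m _.
  by rewrite hornerZ hornerXn monom_sc mulrAC -mulrA.
have := comp0 (enum 'I_n) v0 Om_v0.
rewrite (eq_bigl (pred1 m0)); last first.
  move=> m; apply/allP/eqP => [eq_m|->] //.
  by apply/mnmP => t; apply/eqP/eq_m; rewrite mem_enum.
rewrite -big_filter; have := msupp_uniq g; case: (boolP (m0 \in msupp g)).
  move=> m0_in uniq_g; rewrite filter_pred1_uniq // big_seq1.
  by move/eqP; rewrite mulf_eq0 (negPf v0_neq0) orbF => /eqP.
by move=> m0_notin _ _; apply: memN_msupp_eq0.
Qed.

Lemma mpoly_eval_inj (k : closedFieldType) n (f g : {mpoly k[n]}) :
  (forall v : 'I_n -> k, f.@[v] = g.@[v]) -> f = g.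
Proof.
move=> eq_fg; apply/eqP; rewrite -subr_eq0; apply/eqP/mpolyP => m.
rewrite mcoeff0; apply: (@mcoeff_eq0_scalable _ _ (fun=> True)) => //.
  by move=> v _; rewrite mevalB eq_fg subrr.
exists (fun=> 1) => //; rewrite mevalX.
by rewrite big1 ?oner_eq0 // => i _; rewrite expr1n.
Qed.

(** * Ideals given by generators *)

Lemma ideal_generated_in (k : fieldType) d (G : coord_ring k d -> Prop) g :
  G g -> ideal_generated G g.
Proof.
move=> Gg; exists [:: (1, g)]; rewrite big_seq1 mul1r; split=> // u.
by rewrite inE => /eqP->.
Qed.

Lemma ideal_generatedM (k : fieldType) d (G : coord_ring k d -> Prop) a f :
  ideal_generated G f -> ideal_generated G (a * f).
Proof.
case=> s [Gs ->]; exists [seq (a * u.1, u.2) | u <- s]; split.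
  by move=> u /mapP[w w_s ->]; apply: (Gs w).
by rewrite big_map mulr_sumr; apply: eq_bigr => u _; rewrite mulrA.
Qed.

Lemma ideal_generatedD (k : fieldType) d (G : coord_ring k d -> Prop) f g :
  ideal_generated G f -> ideal_generated G g -> ideal_generated G (f + g).
Proof.
case=> s [Gs ->] [t [Gt ->]]; exists (s ++ t); rewrite big_cat; split=> // u.
by rewrite mem_cat => /orP[/Gs|/Gt].
Qed.

Lemma ideal_generated_sum (k : fieldType) d (G : coord_ring k d -> Prop)
    (I : Type) (r : seq I) (F : I -> coord_ring k d) :
  (forall i, ideal_generated G (F i)) -> ideal_generated G (\sum_(i <- r) F i).
Proof.
move=> GF; apply: big_ind => //; last by move=> f g; apply: ideal_generatedD.
by exists [::]; rewrite big_nil.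
Qed.

Lemma zero_locus_generated (k : fieldType) d (G : coord_ring k d -> Prop) p :
  zero_locus (ideal_generated G) p <-> (forall g, G g -> eval_at p g = 0).
Proof.
split=> [p0 g Gg|p0 f [s [Gs ->]]]; first by apply/p0/ideal_generated_in.
rewrite /eval_at rmorph_sum /= big_seq big1 // => u /Gs /p0 pu.
by rewrite mevalM [X in _ * X]pu mulr0.
Qed.

(** * Linear changes of coordinates, the same in every factor *)

Definition lin_coord (k : fieldType) d (M : 'M[k]_3) (i : 'I_d) (j : 'I_3) :
  coord_ring k d := \sum_l M l j *: coordinate k i l.

Definition lin_subst (k : fieldType) d (M : 'M[k]_3) (f : coord_ring k d) :
  coord_ring k d :=
  f \mPo [tuple mxvec (\matrix_(i, j) lin_coord M i j) 0 t | t < d * 3].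

Lemma eval_coordinate (k : fieldType) d (p : 'M[k]_(d, 3)) i j :
  eval_at p (coordinate k i j) = p i j.
Proof. by rewrite /eval_at mevalXU mxvecE. Qed.

Lemma eval_lin_coord (k : fieldType) d (M : 'M[k]_3) (p : 'M[k]_(d, 3)) i j :
  eval_at p (lin_coord M i j) = (p *m M) i j.
Proof.
rewrite /eval_at rmorph_sum mxE; apply: eq_bigr => l _ /=.
by rewrite mevalZ mulrC; congr (_ * _); apply: eval_coordinate.
Qed.

Lemma eval_lin_subst (k : fieldType) d (M : 'M[k]_3) (p : 'M[k]_(d, 3)) f :
  eval_at p (lin_subst M f) = eval_at (p *m M) f.
Proof.
rewrite /eval_at comp_mpoly_meval; apply: meval_eq => t; rewrite tnth_mktuple.
by case/mxvec_indexP: t => i j; rewrite !mxvecE [in LHS]mxE -eval_lin_coord.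
Qed.

(** Checked on values: [lin_subst M] is pullback along right multiplication by [M], and values
    determine a polynomial over a closed field. *)
Lemma lin_substK (k : closedFieldType) d (M N : 'M[k]_3) :
  M *m N = 1%:M -> cancel (@lin_subst k d N) (lin_subst M).
Proof.
move=> MN f; apply: mpoly_eval_inj => v.
have evE h : h.@[v] = eval_at (vec_mx (\row_t v t)) h.
  by apply: meval_eq => t; rewrite vec_mxK mxE.
by rewrite !evE !eval_lin_subst -mulmxA MN mulmx1.
Qed.

Lemma lin_subst_coordinate (k : fieldType) d (M : 'M[k]_3) (i : 'I_d) j :
  lin_subst M (coordinate k i j) = lin_coord M i j.
Proof.
by rewrite /lin_subst comp_mpolyXU -tnth_nth tnth_mktuple mxvecE mxE.
Qed.

Lemma coordinate_lin_coord (k : fieldType) d (M N : 'M[k]_3) (i : 'I_d) j :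
  M *m N = 1%:M -> coordinate k i j = \sum_l N l j *: lin_coord M i l.
Proof.
move=> MN; under eq_bigr do rewrite /lin_coord scaler_sumr.
rewrite exchange_big /= (bigD1 j) //= [X in _ + X]big1 ?addr0.
  under eq_bigr do rewrite scalerA mulrC.
  have := congr1 (fun A : 'M_3 => A j j) MN.
  by rewrite !mxE eqxx -scaler_suml => ->; rewrite scale1r.
move=> l /negPf neq_lj; under eq_bigr do rewrite scalerA mulrC.
have := congr1 (fun A : 'M_3 => A l j) MN.
by rewrite !mxE neq_lj -scaler_suml => ->; rewrite scale0r.
Qed.

Lemma mxvec_index_inj1 (d : nat) (i i' : 'I_d) (j j' : 'I_3) :
  mxvec_index i j = mxvec_index i' j' -> i = i'.
Proof.
move=> eq_ij; have := mxvecE (\matrix_(a < d, b < 3) a) i j.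
by rewrite eq_ij mxvecE !mxE.
Qed.

(** * Vanishing patterns and the combinatorics of the quiver *)

(** Indices 0, 1, 2 stand for u, v, w: a line is cut out by one of them, a point by the two
    others. *)
Definition vanishes (v : vertex) (j : 'I_3) : bool :=
  match v with
  | LineA => j == 0 | LineB => j == 1 | LineC => j == 2
  | PtA => j != 0   | PtB => j != 1   | PtC => j != 2
  end.

(* The value on the two patterns attached to no vertex is irrelevant. *)
Definition vertex_of (S : 'I_3 -> bool) : vertex :=
  match S 0, S 1, S 2 with
  | true, false, false => LineA
  | false, true, false => LineB
  | false, false, true => LineC
  | false, true, true => PtA
  | true, false, true => PtB
  | _, _, _ => PtC
  end.

Lemma arrow_vanishes v w j : arrow v w -> vanishes v j || vanishes w j.
Proof. by move: j; case: v; case: w => //; apply: forall_ord3. Qed.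

Lemma vanishes_vertex_of (S : 'I_3 -> bool) :
  (exists j, S j) -> (exists j, ~~ S j) -> vanishes (vertex_of S) =1 S.
Proof.
move=> [i Si] [j Sj] l; rewrite /vertex_of.
move: i Si j Sj l; apply: forall_ord3 => Si; apply: forall_ord3 => Sj;
  by move: Si Sj; case E0: (S 0); case E1: (S 1); case E2: (S 2) => //= _ _;
     apply: forall_ord3; rewrite ?E0 ?E1 ?E2.
Qed.

(** Each pattern contains the complement of the other, so both are nonempty as well as proper. Two
    singletons are too small to cover; a line and a point cover when complementary, two points when
    distinct. *)
Lemma arrow_vertex_of (S S' : 'I_3 -> bool) :
  (exists j, ~~ S j) -> (exists j, ~~ S' j) -> (forall j, S j || S' j) ->
  arrow (vertex_of S) (vertex_of S').
Proof.
move=> [i Si] [j Sj] cov; rewrite /vertex_of.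
move: (cov 0) (cov 1) (cov 2).
move: i Si j Sj; apply: forall_ord3 => Si; apply: forall_ord3 => Sj;
  by move: Si Sj; case: (S 0); case: (S 1); case: (S 2);
     case: (S' 0); case: (S' 1); case: (S' 2).
Qed.

Lemma pattern_path d (S : 'I_d -> 'I_3 -> bool) : (2 <= d)%N ->
  (forall i, exists j, ~~ S i j) ->
  (forall i i' : 'I_d, i' = i.+1 :> nat -> forall j, S i j || S i' j) ->
  exists v : d.-tuple vertex,
    is_path v /\ forall i, vanishes (tnth v i) =1 S i.
Proof.
move=> d_ge2 nfull cov; exists [tuple vertex_of (S i) | i < d]; split.
  have i0 : 'I_d by exists 0%N; apply: leq_trans d_ge2.
  apply/(sortedP (vertex_of (S i0))) => n; rewrite size_tuple => lt_n.
  have nthE (i : 'I_d) : nth (vertex_of (S i0))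
      [tuple vertex_of (S i) | i < d] i = vertex_of (S i).
    by rewrite -tnth_nth tnth_mktuple.
  rewrite (nthE (Ordinal (ltnW lt_n))) (nthE (Ordinal lt_n)).
  by apply: arrow_vertex_of => //; apply: cov.
move=> i; rewrite tnth_mktuple; apply: vanishes_vertex_of => //.
(* A coordinate missing from a neighbouring pattern must lie in this one. The neighbour is the
   successor, or the predecessor for the last index; it exists because [d] is at least 2. *)
case: (ltnP i.+1 d) => [lt_i|ge_i].
  have [j Sj] := nfull (Ordinal lt_i); exists j.
  by have := cov i (Ordinal lt_i) erefl j; rewrite (negPf Sj) orbF.
have i_gt0 : (0 < i)%N by rewrite -ltnS; apply: leq_trans d_ge2 _.
have lt_i : (i.-1 < d)%N by apply: leq_ltn_trans (leq_pred i) _.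
have [j Sj] := nfull (Ordinal lt_i); exists j.
by have := cov (Ordinal lt_i) i _ j; rewrite (negPf Sj) /= prednK //; apply.
Qed.

(** * The discrete Fourier transform of order 3 and the relations *)

(** When zeta is a primitive cube root of unity, the rows are coordinates of p_a, p_b, p_c. *)
Definition fourier (k : fieldType) (zeta : k) : 'M[k]_3 :=
  \matrix_(l, j) zeta ^+ (l * j).

Lemma prim3_sqr (k : fieldType) (zeta : k) :
  3.-primitive_root zeta -> zeta ^+ 2 = - 1 - zeta.
Proof.
move=> hz; have z3 := prim_expr_order hz.
have z1 : zeta - 1 != 0.
  by rewrite subr_eq0 -[zeta]expr1 -(prim_order_dvd hz).
by apply: (mulfI z1); ring: z3.
Qed.

Lemma fourierK (k : fieldType) (zeta : k) : 3.-primitive_root zeta ->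
  fourier zeta *m fourier (zeta ^+ 2) = 3%:M.
Proof.
move=> hz; have z2 := prim3_sqr hz.
by apply/matrixP; apply: forall_ord3; apply: forall_ord3;
   rewrite !mxE sum_ord3 !mxE /=; ring: z2.
Qed.

Lemma fourierVK (k : fieldType) (zeta : k) : 3.-primitive_root zeta ->
  fourier (zeta ^+ 2) *m fourier zeta = 3%:M.
Proof.
move=> hz; have z2 := prim3_sqr hz.
by apply/matrixP; apply: forall_ord3; apply: forall_ord3;
   rewrite !mxE sum_ord3 !mxE /=; ring: z2.
Qed.

(** The matrix [fourier (zeta ^+ 2)] sends row [j0] of [fourier zeta] to three times a basis vector,
    so being that point means having a transform supported at [j0]. *)
Lemma point_fourierP (k : fieldType) (zeta : k) (q : 'rV[k]_3) (j0 : 'I_3) :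
  3.-primitive_root zeta -> 3 != 0 :> k -> q != 0 ->
  same_point q (row j0 (fourier zeta)) <->
  (forall j, j != j0 -> (q *m fourier (zeta ^+ 2)) 0 j = 0).
Proof.
move=> hz n3 q_neq0; split=> [[c _ ->] j /negPf neq_j|q0].
  rewrite -scalemxAl -row_mul fourierK // !mxE eq_sym neq_j mulr0n.
  exact: mulr0.
set t := (q *m fourier (zeta ^+ 2)) 0 j0.
have qE : q = (3^-1 * t) *: row j0 (fourier zeta).
  have tE : q *m fourier (zeta ^+ 2) = t *: delta_mx 0 j0.
    apply/rowP => j; rewrite [RHS]mxE [X in _ * X]mxE eqxx /=.
    by have [->|/q0->] := eqVneq j j0; rewrite ?mulr1 ?mulr0.
  have := congr1 (fun r => 3^-1 *: (r *m fourier zeta)) tE.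
  rewrite -mulmxA fourierVK // mul_mx_scalar scalerA mulVf // scale1r => ->.
  by rewrite -scalemxAl scalerA -rowE.
exists (3^-1 * t) => //; apply: contraNneq q_neq0 => c0.
by rewrite qE c0 scale0r.
Qed.

Lemma in_vertexP (k : fieldType) (zeta : k) (v : vertex) (q : 'rV[k]_3) :
  3.-primitive_root zeta -> 3 != 0 :> k -> q != 0 ->
  in_vertex zeta v q <->
  (forall j, vanishes v j -> (q *m fourier (zeta ^+ 2)) 0 j = 0).
Proof.
move=> hz n3 q_neq0; have z3 := prim_expr_order hz.
have lineP (j0 : 'I_3) (a : k) :
    (q *m fourier (zeta ^+ 2)) 0 j0 = a ->
    a = 0 <-> (forall j, j == j0 -> (q *m fourier (zeta ^+ 2)) 0 j = 0).
  by move=> <-; split=> [a0 j /eqP->|/(_ j0 (eqxx _))].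
have rowE3 (j0 : 'I_3) (a b c : k) : zeta ^+ 0 = a -> zeta ^+ j0 = b ->
    zeta ^+ (j0 * 2) = c -> hcoords a b c = row j0 (fourier zeta).
  move=> <- <- <-; apply/rowP; apply: forall_ord3; rewrite !mxE //=.
    by rewrite muln0.
  by rewrite muln1.
case: v => /=.
- by apply: lineP => //; rewrite !mxE sum_ord3 !mxE /=; ring.
- by apply: lineP => //; rewrite !mxE sum_ord3 !mxE /=; ring: z3.
- by apply: lineP => //; rewrite !mxE sum_ord3 !mxE /=; ring: z3.
- by rewrite (rowE3 0) //; apply: point_fourierP.
- by rewrite (rowE3 1) //; apply: point_fourierP.
- rewrite (rowE3 2) //; first exact: point_fourierP.
  by rewrite -(prim_expr_mod hz).
Qed.

(** With x, y, z indexed by 0, 1, 2 modulo 3, [rel_f], [rel_h], [rel_g] collect the products whose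
    indices sum to 0, 1, 2. They form a cyclic convolution, which the Fourier transform turns into
    coordinatewise products. *)
Lemma lin_coordM (k : fieldType) (zeta : k) d (i i' : 'I_d) :
  3.-primitive_root zeta ->
  let L j := lin_coord (fourier (zeta ^+ 2)) i j *
             lin_coord (fourier (zeta ^+ 2)) i' j in
  let Z := zeta%:MP in
  [/\ L 0 = rel_f k i i' + rel_g k i i' + rel_h k i i',
      L 1 = rel_f k i i' + Z * rel_g k i i' + Z ^+ 2 * rel_h k i i' &
      L 2 = rel_f k i i' + Z ^+ 2 * rel_g k i i' + Z * rel_h k i i'].
Proof.
move=> hz L Z; have Z3 : Z ^+ 3 = 1 by rewrite -rmorphXn /= (prim_expr_order hz).
rewrite /L /lin_coord /rel_f /rel_g /rel_h !sum_ord3 !mxE /= -!mul_mpolyC.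
rewrite !rmorphXn /= -/Z.
by split; ring: Z3.
Qed.

Lemma truncated_point_ideal_lin (k : fieldType) (zeta : k) d (i i' : 'I_d) j :
  3.-primitive_root zeta -> i' = i.+1 :> nat ->
  truncated_point_ideal (lin_coord (fourier (zeta ^+ 2)) i j *
                         lin_coord (fourier (zeta ^+ 2)) i' j).
Proof.
move=> hz ii'; have [L0 L1 L2] := lin_coordM i i' hz.
have If : truncated_point_ideal (rel_f k i i').
  by apply: ideal_generated_in; exists i, i'; split=> //; constructor.
have Ig : truncated_point_ideal (rel_g k i i').
  by apply: ideal_generated_in; exists i, i'; split=> //; constructor.
have Ih : truncated_point_ideal (rel_h k i i').
  by apply: ideal_generated_in; exists i, i'; split=> //; constructor.
move: j; apply: forall_ord3; rewrite ?L0 ?L1 ?L2;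
  by do !apply: ideal_generatedD => //; apply: ideal_generatedM.
Qed.

Lemma fourier_eq0 (k : fieldType) (zeta a b c : k) :
  3.-primitive_root zeta -> 3 != 0 :> k ->
  a + b + c = 0 -> a + zeta * b + zeta ^+ 2 * c = 0 ->
  a + zeta ^+ 2 * b + zeta * c = 0 -> [/\ a = 0, b = 0 & c = 0].
Proof.
move=> hz n3; have z2 := prim3_sqr hz.
set u := a + b + c; set v := a + _ + _; set w := a + _ + _ => u0 v0 w0.
have a3 : 3 * a = u + v + w by rewrite /u /v /w; ring: z2.
have b3 : 3 * b = u + zeta ^+ 2 * v + zeta * w by rewrite /u /v /w; ring: z2.
have c3 : 3 * c = u + zeta * v + zeta ^+ 2 * w by rewrite /u /v /w; ring: z2.
by split; apply: (mulfI n3); rewrite ?a3 ?b3 ?c3 u0 v0 w0 !mulr0 !addr0.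
Qed.

(** * The points of V_d *)

Lemma zero_locus_truncatedP (k : fieldType) (zeta : k) d (p : 'M[k]_(d, 3)) :
  3.-primitive_root zeta -> 3 != 0 :> k ->
  zero_locus (@truncated_point_ideal k d) p <->
  (forall i i' : 'I_d, i' = i.+1 :> nat -> forall j,
     (p *m fourier (zeta ^+ 2)) i j * (p *m fourier (zeta ^+ 2)) i' j = 0).
Proof.
move=> hz n3; split=> [p0 i i' ii' j|p0].
  rewrite -!eval_lin_coord -[LHS](mevalM (fun t => mxvec p 0 t)).
  exact/p0/truncated_point_ideal_lin.
apply/zero_locus_generated => r [i [i' [ii' r_rel]]].
have [] := lin_coordM i i' hz.
move: (rel_f k i i') (rel_g k i i') (rel_h k i i') r_rel => F G H r_rel L0 L1 L2.
pose ev f := eval_at p f.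
have evD f g : ev (f + g) = ev f + ev g by apply: mevalD.
have evM f g : ev (f * g) = ev f * ev g by apply: mevalM.
have evC c : ev c%:MP = c by apply: mevalC.
have L_eq0 j : ev (lin_coord (fourier (zeta ^+ 2)) i j *
                   lin_coord (fourier (zeta ^+ 2)) i' j) = 0.
  by rewrite evM /ev !eval_lin_coord p0.
move: (L_eq0 0) (L_eq0 1) (L_eq0 2); rewrite L0 L1 L2.
(* Squares are unfolded so that [ev] passes through the powers of the constant zeta, then folded
   back to match [fourier_eq0]. *)
rewrite !expr2 !evD !evM !evC -!expr2 -/(ev r) => e0 e1 e2.
by have [f0 g0 h0] := fourier_eq0 hz n3 e0 e1 e2; case: r_rel => ->.
Qed.

Lemma multipoint_mulmx (k : fieldType) d (M N : 'M[k]_3) (p : 'M[k]_(d, 3)) :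
  M *m N = 1%:M -> is_multipoint p -> is_multipoint (p *m M).
Proof.
move=> MN p_neq0 i; apply: contraNneq (p_neq0 i) => pM0.
by rewrite -[row i p]mulmx1 -MN mulmxA -row_mul pM0 mul0mx.
Qed.

Lemma row_neq0P (k : fieldType) d (p : 'M[k]_(d, 3)) i :
  row i p != 0 <-> exists j, p i j != 0.
Proof.
split=> [/rV0Pn[j]|[j pij]]; first by rewrite mxE; exists j.
by apply/rV0Pn; exists j; rewrite mxE.
Qed.

Lemma zero_locus_pathP (k : fieldType) (zeta : k) d (p : 'M[k]_(d, 3)) :
  3.-primitive_root zeta -> 3 != 0 :> k -> (2 <= d)%N -> is_multipoint p ->
  zero_locus (@truncated_point_ideal k d) p <->
  exists v : d.-tuple vertex, is_path v /\ path_product zeta v p.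
Proof.
move=> hz n3 d_ge2 p_neq0.
have rowp v i : in_vertex zeta v (row i p) <->
    forall j, vanishes v j -> (p *m fourier (zeta ^+ 2)) i j = 0.
  have [] := in_vertexP v hz n3 (p_neq0 i); rewrite -row_mul => vp pv.
  split=> [/vp H j /H|H]; first by rewrite [row _ _ _ _]mxE.
  by apply: pv => j /H; rewrite [row _ _ _ _]mxE.
split=> [/(zero_locus_truncatedP _ hz n3) p0|[v [path_v pv]]].
  (* The pattern of row [i] is proper because an invertible matrix keeps the row nonzero. *)
  pose S i j := (p *m fourier (zeta ^+ 2)) i j == 0.
  have [||v [path_v vS]] := @pattern_path d S d_ge2.
  - move=> i; apply/(row_neq0P (p *m fourier (zeta ^+ 2))).
    apply: (@multipoint_mulmx _ _ _ (3^-1 *: fourier zeta)) => //.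
    by rewrite -scalemxAr fourierVK // scale_scalar_mx mulVf.
  - by move=> i i' ii' j; rewrite /S -mulf_eq0 p0.
  by exists v; split=> // i; apply/rowp => j; rewrite vS => /eqP.
apply/(zero_locus_truncatedP _ hz n3) => i i' ii' j.
have lt_i' : (i.+1 < size v)%N by rewrite size_tuple -ii'.
have := sortedP LineA path_v; move/(_ i lt_i'); rewrite -ii' -!tnth_nth.
move=> /(arrow_vanishes j)/orP[vi|vi'].
  by rewrite (proj1 (rowp _ i) (pv i) j vi) mul0r.
by rewrite (proj1 (rowp _ i') (pv i') j vi') mulr0.
Qed.

(** * The scheme structure on the charts *)

(* A monomial in the diagonal coordinates that uses some coordinate of every
   row either is divisible by a generator or survives on an allowed stratum,
   where its coefficient must vanish. *)
Lemma diagonal_chart (k : closedFieldType) (zeta : k) d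
    (f : coord_ring k d) (e : 'I_d -> 'I_3) :
  3.-primitive_root zeta -> 3 != 0 :> k ->
  (forall p, is_multipoint p -> zero_locus (@truncated_point_ideal k d) p ->
     eval_at p f = 0) ->
  truncated_point_ideal
    (\prod_i lin_coord (fourier (zeta ^+ 2)) i (e i) * f).
Proof.
move=> hz n3 f0; set P := fourier (zeta ^+ 2).
pose Q : 'M[k]_3 := 3^-1 *: fourier zeta.
have PQ : P *m Q = 1%:M.
  by rewrite -scalemxAr fourierVK // scale_scalar_mx mulVf.
have QP : Q *m P = 1%:M by apply: mulmx1C.
pose g := lin_subst Q f.
have fE : f = lin_subst P g by rewrite lin_substK.
pose E := (\sum_i U_(mxvec_index i (e i)))%MM.
have -> : \prod_i lin_coord P i (e i) = lin_subst P 'X_[E].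
  rewrite (big_morph _ (@mpolyXD _ k) (@mpolyX0 _ k)) /lin_subst rmorph_prod /=.
  apply: eq_bigr => i _.
  by rewrite -lin_subst_coordinate.
rewrite fE [g]mpolyE /lin_subst -rmorphM /= mulr_sumr rmorph_sum /=.
apply: ideal_generated_sum => m.
rewrite -scalerAr linearZ /= -mul_mpolyC -mpolyXD.
set m' := (E + m)%MM.
pose T i j := m' (mxvec_index i j) != 0%N.
have T_e i : T i (e i).
  by rewrite /T mnmDE mnm_sumE (bigD1 i) //= mnm1E eqxx.
have [[i [i' [ii' [j /andP[Tij Ti'j]]]]]|indep] :
    (exists i i' : 'I_d, i' = i.+1 :> nat /\ exists j, T i j && T i' j) \/
    (forall i i' : 'I_d, i' = i.+1 :> nat -> forall j, ~~ (T i j && T i' j)).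
  case: (boolP [exists i : 'I_d, exists i' : 'I_d,
           (i' == i.+1 :> nat) && [exists j, T i j && T i' j]]).
    move=> /existsP[i /existsP[i' /andP[/eqP ii' /existsP[j Tj]]]].
    by left; exists i, i'; split=> //; exists j.
  move=> /existsPn H; right=> i i' ii' j; move: (H i) => /existsPn/(_ i').
  by rewrite ii' eqxx /= => /existsPn.
- apply: ideal_generatedM.
  pose D := (U_(mxvec_index i j) + U_(mxvec_index i' j))%MM.
  have le_D : (D <= m')%MM.
    apply/mnm_lepP => t; rewrite mnmDE !mnm1E.
    have [eq_t|_] := eqVneq _ t.
      (* The two variables lie in different rows, so no exponent of [D] exceeds 1. *)
      rewrite (_ : (_ == t) = false) ?addn0 -?eq_t ?lt0n //.
      apply/eqP => /mxvec_index_inj1 eq_i.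
      by move: ii'; rewrite eq_i => /n_Sn.
    by have [<-|//] := eqVneq; rewrite lt0n.
  rewrite -(submK le_D) !mpolyXD !rmorphM /=; apply: ideal_generatedM.
  have := truncated_point_ideal_lin j hz ii'.
  by rewrite -!lin_subst_coordinate.
suff -> : g@_m = 0.
  by rewrite mpolyC0 mul0r; exists [::]; rewrite big_nil.
(* Points whose nonzero coordinates are exactly those occurring in [m']. Row [i] keeps coordinate
   [e i] and consecutive rows share no nonzero coordinate, so these are points of V_d in diagonal
   coordinates. *)
pose Om (q : 'I_(d * 3) -> k) :=
  forall i j, (q (mxvec_index i j) != 0) = T i j.
apply: (@mcoeff_eq0_scalable _ _ Om).
- move=> v t a a_neq0 Om_v i j; case: ifP => _ //.
  by rewrite mulf_eq0 negb_or a_neq0 Om_v.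
- move=> v Om_v.
  pose q : 'M[k]_(d, 3) := vec_mx (\row_t v t).
  have -> : g.@[v] = eval_at q g.
    by apply: meval_eq => t; rewrite vec_mxK mxE.
  have qE i j : q i j = v (mxvec_index i j) by rewrite !mxE.
  rewrite eval_lin_subst; apply: f0.
    apply: multipoint_mulmx QP _ => i; apply/row_neq0P.
    by exists (e i); rewrite qE Om_v.
  apply/(zero_locus_truncatedP _ hz n3) => i i' ii' j.
  rewrite -mulmxA QP mulmx1 !qE; apply/eqP.
  by rewrite mulf_eq0 -[X in X || _]negbK -[X in _ || X]negbK !Om_v -negb_and indep.
(* The indicator of the support of [m'] lies in [Om]; every variable of [m] divides [m'], so the
   monomial [m] takes a nonzero value there. *)
- exists (fun t => (m' t != 0%N)%:R).
    by move=> i j; rewrite -/(T i j); case: (T i j); rewrite ?oner_eq0 ?eqxx.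
  rewrite mevalX; apply/prodf_neq0 => t _.
  case: (eqVneq (m t) 0%N) => [->|m_neq0]; first by rewrite oner_eq0.
  by rewrite mnmDE addn_eq0 negb_and m_neq0 orbT expr1n oner_eq0.
Qed.

Lemma standard_chart (k : closedFieldType) (zeta : k) d
    (f : coord_ring k d) (c : 'I_d -> 'I_3) :
  3.-primitive_root zeta -> 3 != 0 :> k ->
  (forall p, is_multipoint p -> zero_locus (@truncated_point_ideal k d) p ->
     eval_at p f = 0) ->
  truncated_point_ideal (\prod_i coordinate k i (c i) * f).
Proof.
move=> hz n3 f0.
have PQ : fourier (zeta ^+ 2) *m (3^-1 *: fourier zeta) = 1%:M.
  by rewrite -scalemxAr fourierVK // scale_scalar_mx mulVf.
under eq_bigr do rewrite (coordinate_lin_coord _ _ PQ).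
(* Expanding the product of sums gives one diagonal product for each choice [e] of a coordinate per
   factor. *)
rewrite bigA_distr_bigA /= mulr_suml; apply: ideal_generated_sum => e.
under eq_bigr do rewrite -mul_mpolyC.
rewrite big_split /= -mulrA; apply: ideal_generatedM.
exact: diagonal_chart.
Qed.

Theorem proposition5 (k : closedFieldType) (hchar : [pchar k] =i pred0)
  (zeta : k) (hzeta : 3.-primitive_root zeta) (d : nat) (hd : (2 <= d)%N) :
  same_closed_subscheme (@truncated_point_ideal k d) (@path_union_ideal k zeta d)
  /\
  (forall p : 'M[k]_(d, 3), is_multipoint p ->
     (zero_locus (@truncated_point_ideal k d) p <->
      exists v : d.-tuple vertex, is_path v /\ path_product zeta v p)).
Proof.
have n3 : 3 != 0 :> k by rewrite (proj1 (pcharf0P k) hchar).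
have locusP p := @zero_locus_pathP k zeta d p hzeta n3 hd.
have vanish (I : coord_ring k d -> Prop) f p : is_multipoint p ->
    zero_locus I p -> saturation I f -> eval_at p f = 0.
  move=> p_neq0 p0 sat_f.
  (* The chart [c] is chosen to contain [p], so the chart monomial is nonzero at [p] and can be
     cancelled. *)
  have /fin_all_exists[c pc] i : exists j, p i j != 0 by apply/row_neq0P.
  have [N /p0/eqP] := sat_f c.
  rewrite /eval_at rmorphM rmorphXn rmorph_prod mulf_eq0 => /orP[|/eqP//].
  rewrite expf_eq0 => /andP[_]; rewrite prodf_seq_eq0 => /hasP[i _] /=.
  by rewrite [X in X == 0]eval_coordinate (negPf (pc i)).
split; last exact: locusP.
move=> f; split=> sat_f c.
  (* A vanishing ideal is already saturated, so exponent 0 suffices. *)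
  exists 0%N; rewrite expr0 mul1r => v path_v p p_neq0 pv.
  by apply: vanish sat_f => //; apply/locusP => //; exists v.
(* By [standard_chart], a single power of the chart monomial suffices. *)
exists 1%N; rewrite expr1; apply: (standard_chart _ hzeta n3) => p p_neq0.
move=> /locusP[] // v [path_v pv]; apply: vanish sat_f => // h h0.
exact: h0 path_v _ p_neq0 pv.
Qed.
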